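(* Let $H$ be a Hopf algebra over a field $\Bbbk$ with bijective antipode, let $A$ be an idempotent algebra (i.e. $A^2=A$) which is a partial $H$-module algebra with symmetrical partial action, and let $(B,\theta)$ be a globalization for $A$. Then there exists a strict Morita context between $\underline{A\#H}$ and $B\#H$.
   Context: Algebras are associative $\Bbbk$-algebras, not necessarily unital; $\Delta(h)=\sum h_{(1)}\otimes h_{(2)}$. A partial action of $H$ on $A$ is a linear map $\cdot:H\otimes A\to A$ with, for all $a,b\in A$, $h,k\in H$: $1_H\cdot a=a$ and $h\cdot(a(k\cdot b))=\sum(h_{(1)}\cdot a)(h_{(2)}k\cdot b)$; $A$ is then a partial $H$-module algebra. It is symmetrical if also $h\cdot((k\cdot b)a)=\sum(h_{(1)}k\cdot b)(h_{(2)}\cdot a)$. A (possibly nonunital) $H$-module algebra is an algebra that is a left $H$-module via $\triangleright$ with $h\triangleright(bc)=\sum(h_{(1)}\triangleright b)(h_{(2)}\triangleright c)$. A globalization for a symmetrical partial action $\cdot$ on $A$ is a pair $(B,\theta)$ such that: (1) $B$ is a (possibly nonunital) $H$-module algebra with action $\triangleright$; (2) $\theta:A\to B$ is an injective algebra morphism; (3) $\theta((h\cdot a)b)=(h\triangleright\theta(a))\theta(b)$ and $\theta(b(h\cdot a))=\theta(b)(h\triangleright\theta(a))$ for all $a,b\in A$, $h\in H$; (4) $B=H\triangleright\theta(A)$ (the linear span of all $h\triangleright\theta(a)$); (5) $h\bullet\theta(a)=\theta(h\cdot a)$ defines a partial action of $H$ on $\theta(A)$. For a partial (or global) $H$-module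 algebra $A$, the smash product $A\#H$ is the vector space $A\otimes H$ with product $(a\#h)(b\#k)=\sum a(h_{(1)}\cdot b)\#h_{(2)}k$; the partial smash product is the subalgebra $\underline{A\#H}=(A\#H)(A\#1_H)$, spanned by the elements $\sum a(h_{(1)}\cdot b)\#h_{(2)}$. A Morita context $(R,S,{}_RM_S,{}_SN_R,\tau,\sigma)$ consists of algebras $R,S$, bimodules $M,N$, an $R$-bimodule map $\tau:M\otimes_SN\to R$ and an $S$-bimodule map $\sigma:N\otimes_RM\to S$ with $\tau(m\otimes n)m'=m\,\sigma(n\otimes m')$ and $\sigma(n\otimes m)n'=n\,\tau(m\otimes n')$; it is strict if $\tau$ and $\sigma$ are surjective. *)

(* Defs.v *)
From HB Require Import structures.
From mathcomp Require Import all_boot all_order all_algebra.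
From mathcomp Require Import boolp classical_sets.

Set Implicit Arguments.
Unset Strict Implicit.
Unset Printing Implicit Defensive.

Import GRing.Theory.
Local Open Scope ring_scope.
Local Open Scope quotient_scope.
Local Open Scope classical_set_scope.

Section Bilin.
Variables (k : fieldType) (V W U : lmodType k).

Definition bilin (f : V -> W -> U) : Prop :=
  (forall w, linear (f^~ w)) /\ (forall v, linear (f v)).

Definition lspan (X : set V) : set V :=
  [set v | exists2 s : seq (k * V),
     (forall p, p \in s -> X p.2) & v = \sum_(p <- s) p.1 *: p.2].

End Bilin.

(* V ⊗_S W for k-vector spaces V and W, with S acting on V from the right by ra
   and on W from the left by la: formal sums of pairs modulo the congruence
   generated by the tensor relations. S need not be unital, so k-balancing is
   imposed separately from S-balancing. The scalar c in the last relation makes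
   it stable under scaling; it is superfluous when ra and la are k-linear. *)
Section BalancedTensor.
Variables (k : fieldType) (V W : lmodType k) (S : Type).
Variables (ra : V -> S -> V) (la : S -> W -> W).

Inductive bteq : seq (V * W) -> seq (V * W) -> Prop :=
| bteq_refl s : bteq s s
| bteq_sym s t : bteq s t -> bteq t s
| bteq_trans s t u : bteq s t -> bteq t u -> bteq s u
| bteq_cat s s' t t' : bteq s s' -> bteq t t' -> bteq (s ++ t) (s' ++ t')
| bteq_catC s t : bteq (s ++ t) (t ++ s)
| bteq_0l w : bteq [:: (0, w)] [::]
| bteq_0r v : bteq [:: (v, 0)] [::]
| bteq_Dl v v' w : bteq [:: (v + v', w)] [:: (v, w); (v', w)]
| bteq_Dr v w w' : bteq [:: (v, w + w')] [:: (v, w); (v, w')]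
| bteq_Z c v w : bteq [:: (c *: v, w)] [:: (v, c *: w)]
| bteq_bal c v s w : bteq [:: (c *: ra v s, w)] [:: (c *: v, la s w)].

Definition bteqb (s t : seq (V * W)) : bool := `[< bteq s t >].

Lemma bteqb_equiv : equiv_class_of bteqb.
Proof.
split.
- by move=> s; apply/asboolP; apply: bteq_refl.
- by move=> s t; apply/asboolP/asboolP => /bteq_sym.
- by move=> t s u /asboolP st /asboolP tu; apply/asboolP; apply: bteq_trans tu.
Qed.

Canonical bteqb_rel := EquivRelPack bteqb_equiv.

Definition btensor : Type := {eq_quot bteqb_rel}.
HB.instance Definition _ := Choice.copy btensor {eq_quot bteqb_rel}.
HB.instance Definition _ := Quotient.copy btensor {eq_quot bteqb_rel}.

Notation cl s := (\pi_btensor (s : seq (V * W))).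

Definition bt (v : V) (w : W) : btensor := cl [:: (v, w)].

Lemma btP s t : cl s = cl t <-> bteq s t.
Proof.
by split=> [/(@eqmodP _ bteqb_rel)/asboolP//|st]; apply/(@eqmodP _ bteqb_rel)/asboolP.
Qed.

Definition bt_add (x y : btensor) : btensor := cl (repr x ++ repr y).
Definition bt_scale (c : k) (x : btensor) : btensor :=
  cl [seq (c *: p.1, p.2) | p <- repr x].

Lemma repr_bteq s : bteq (repr (cl s)) s.
Proof. by apply/btP; rewrite reprK. Qed.

Lemma bteq_map c s t : bteq s t ->
  bteq [seq (c *: p.1, p.2) | p <- s] [seq (c *: p.1, p.2) | p <- t].
Proof.
elim=> {s t} /=.
- by move=> s; apply: bteq_refl.
- by move=> s t _; apply: bteq_sym.
- by move=> s t u _ + _; apply: bteq_trans.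
- by move=> s s' t t' _ + _; rewrite !map_cat; apply: bteq_cat.
- by move=> s t; rewrite !map_cat; apply: bteq_catC.
- by move=> w; rewrite scaler0; apply: bteq_0l.
- by move=> v; apply: bteq_0r.
- by move=> v v' w; rewrite scalerDr; apply: bteq_Dl.
- by move=> v w w'; apply: bteq_Dr.
- by move=> d v w; rewrite scalerA mulrC -scalerA; apply: bteq_Z.
- by move=> d v s w; rewrite !scalerA; apply: bteq_bal.
Qed.

Lemma bt_addE s t : bt_add (cl s) (cl t) = cl (s ++ t).
Proof. by apply/btP; apply: bteq_cat; apply: repr_bteq. Qed.

Lemma bt_scaleE c s : bt_scale c (cl s) = cl [seq (c *: p.1, p.2) | p <- s].
Proof. by apply/btP; apply: bteq_map; apply: repr_bteq. Qed.

Lemma bteq_cons p s t : bteq s t -> bteq (p :: s) (p :: t).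
Proof. exact: (bteq_cat (bteq_refl [:: p])). Qed.

Lemma bt_addA : associative bt_add.
Proof.
move=> x y z; rewrite -(reprK x) -(reprK y) -(reprK z).
move: (repr x) (repr y) (repr z) => s t u.
by rewrite (bt_addE t u) (bt_addE s t) (bt_addE s) (bt_addE _ u) catA.
Qed.

Lemma bt_addC : commutative bt_add.
Proof. by move=> x y; apply/btP; apply: bteq_catC. Qed.

Lemma bt_add0 : left_id (cl [::]) bt_add.
Proof. by move=> x; rewrite -(reprK x) bt_addE. Qed.

Lemma bt_scaleA a b x : bt_scale a (bt_scale b x) = bt_scale (a * b) x.
Proof.
rewrite -(reprK x); move: (repr x) => s.
rewrite (bt_scaleE b s) !bt_scaleE -map_comp; congr (cl _).
by apply: eq_map => p /=; rewrite scalerA.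
Qed.

Lemma bt_scale1 : left_id 1 bt_scale.
Proof.
move=> x; rewrite -{2}(reprK x) /bt_scale; congr (cl _).
by rewrite -[RHS]map_id; apply: eq_map => -[v w] /=; rewrite scale1r.
Qed.

Lemma bt_scaleDr : right_distributive bt_scale bt_add.
Proof.
move=> c x y; rewrite -(reprK x) -(reprK y).
move: (repr x) (repr y) => s t.
by rewrite (bt_addE s t) (bt_scaleE c s) (bt_scaleE c t) bt_scaleE bt_addE map_cat.
Qed.

Lemma bt_scaleDl x : {morph bt_scale^~ x : a b / a + b >-> bt_add a b}.
Proof.
move=> a b; rewrite -(reprK x) !bt_scaleE bt_addE; apply/btP.
elim: (repr x) => [|[v w] s IHs] /=; first exact: bteq_refl.
rewrite scalerDl.
apply: (bteq_trans (bteq_cat (bteq_Dl _ _ _) IHs)) => /=.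
apply: bteq_cons; rewrite -cat1s catA -[_ :: map _ _ in X in bteq _ X]cat1s catA.
by apply: bteq_cat; [apply: bteq_catC | apply: bteq_refl].
Qed.

Lemma bt_addN : left_inverse (cl [::]) (bt_scale (-1)) bt_add.
Proof.
have s0 x : bt_scale 0 x = cl [::].
  rewrite -(reprK x) bt_scaleE; apply/btP.
  elim: (repr x) => [|[v w] s IHs] /=; first exact: bteq_refl.
  by rewrite scale0r; apply: (bteq_cat (bteq_0l w) IHs).
by move=> x; rewrite -[X in bt_add _ X]bt_scale1 -bt_scaleDl addNr s0.
Qed.

HB.instance Definition _ :=
  GRing.isZmodule.Build btensor bt_addA bt_addC bt_add0 bt_addN.
HB.instance Definition _ := GRing.Zmodule_isLmodule.Build k btensor
  bt_scaleA bt_scale1 bt_scaleDr bt_scaleDl.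

Lemma btDl v v' w : bt (v + v') w = bt v w + bt v' w.
Proof. by rewrite [RHS]bt_addE; apply/btP; apply: bteq_Dl. Qed.

Lemma btDr v w w' : bt v (w + w') = bt v w + bt v w'.
Proof. by rewrite [RHS]bt_addE; apply/btP; apply: bteq_Dr. Qed.

Lemma btZl c v w : bt (c *: v) w = c *: bt v w.
Proof. by rewrite [RHS]bt_scaleE. Qed.

Lemma btZr c v w : bt v (c *: w) = c *: bt v w.
Proof. by rewrite -btZl; apply/esym/btP; apply: bteq_Z. Qed.

Lemma bt_bal v s w : bt (ra v s) w = bt v (la s w).
Proof.
by apply/btP; rewrite -[ra v s]scale1r -[v in X in bteq _ X]scale1r; apply: bteq_bal.
Qed.

Lemma bt_bilin : bilin bt.
Proof.
by split=> [w|v] c x y; rewrite /= ?btDl ?btDr ?btZl ?btZr.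
Qed.

Lemma btE (x : btensor) : x = \sum_(p <- repr x) bt p.1 p.2.
Proof.
rewrite -{1}(reprK x); elim: (repr x) => [|[v w] s IHs]; first by rewrite big_nil.
by rewrite big_cons -IHs [RHS]bt_addE.
Qed.

Section Lift.
Variables (U : lmodType k).

(* The map induced on V ⊗_S W by f; independent of the representative, and
   k-linear, when f is bilinear and S-balanced (bt_liftE, bt_lift_linear). *)
Definition bt_lift (f : V -> W -> U) (x : btensor) : U :=
  \sum_(p <- repr x) f p.1 p.2.

Definition balanced (f : V -> W -> U) : Prop :=
  forall v s w, f (ra v s) w = f v (la s w).

Variables (f : V -> W -> U) (fbilin : bilin f) (fbal : balanced f).

Lemma bteq_lift s t : bteq s t ->
  \sum_(p <- s) f p.1 p.2 = \sum_(p <- t) f p.1 p.2.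
Proof.
case: fbilin => fl fr.
have f0l w : f 0 w = 0 by have := fl w (-1) 0 0; rewrite scaler0 addr0 scaleN1r addNr.
have f0r v : f v 0 = 0 by have := fr v (-1) 0 0; rewrite scaler0 addr0 scaleN1r addNr.
have fZl c v w : f (c *: v) w = c *: f v w by have := fl w c v 0; rewrite /= f0l !addr0.
have fZr c v w : f v (c *: w) = c *: f v w by have := fr v c w 0; rewrite /= f0r !addr0.
have fDl v v' w : f (v + v') w = f v w + f v' w.
  by have := fl w 1 v v'; rewrite /= !scale1r.
have fDr v w w' : f v (w + w') = f v w + f v w'.
  by have := fr v 1 w w'; rewrite /= !scale1r.
elim=> {s t} //=.
- by move=> s t u _ -> _.
- by move=> s s' t t' _ e _ e'; rewrite !big_cat /= e e'.
- by move=> s t; rewrite !big_cat /= addrC.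
- by move=> w; rewrite big_seq1 big_nil f0l.
- by move=> v; rewrite big_seq1 big_nil f0r.
- by move=> v v' w; rewrite !big_cons !big_nil !addr0 fDl.
- by move=> v w w'; rewrite !big_cons !big_nil !addr0 fDr.
- by move=> c v w; rewrite !big_seq1 /= fZl fZr.
- by move=> c v s w; rewrite !big_seq1 /= !fZl fbal.
Qed.

Lemma bt_liftE v w : bt_lift f (bt v w) = f v w.
Proof. by rewrite /bt_lift (bteq_lift (repr_bteq [:: (v, w)])) big_seq1. Qed.

Lemma bt_lift_linear : linear (bt_lift f).
Proof.
move=> c x y; rewrite /bt_lift.
have -> : c *: x + y = cl ([seq (c *: p.1, p.2) | p <- repr x] ++ repr y).
  by rewrite -bt_addE reprK.
rewrite (bteq_lift (repr_bteq _)) big_cat /= big_map scaler_sumr; congr (_ + _).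
apply: eq_bigr => p _ /=; case: fbilin => fl _.
have f0l w : f 0 w = 0 by have := fl w (-1) 0 0; rewrite scaler0 addr0 scaleN1r addNr.
by have := fl p.2 c p.1 0; rewrite /= f0l !addr0.
Qed.

End Lift.

Section Ext.
Variable U : lmodType k.

Lemma linear_sumE (g : btensor -> U) (s : seq (V * W)) : linear g ->
  g (\sum_(p <- s) bt p.1 p.2) = \sum_(p <- s) g (bt p.1 p.2).
Proof.
move=> gl; have g0 : g 0 = 0.
  by have := gl (-1) 0 0; rewrite scaler0 addr0 scaleN1r addNr.
elim: s => [|p s IHs]; first by rewrite !big_nil.
by rewrite !big_cons -IHs; have := gl 1 (bt p.1 p.2) (\sum_(j <- s) bt j.1 j.2); rewrite !scale1r.
Qed.

Lemma bt_ext (f g : btensor -> U) : linear f -> linear g ->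
  (forall v w, f (bt v w) = g (bt v w)) -> forall x, f x = g x.
Proof.
move=> fl gl fg x; rewrite (btE x) !linear_sumE //.
by apply: eq_bigr => p _; apply: fg.
Qed.

End Ext.

End BalancedTensor.

Section Tensor.
Variables (k : fieldType) (V W : lmodType k).

(* V ⊗_k W: balancing over k is already part of the tensor relations. *)
Definition tensor : Type :=
  btensor (fun (v : V) (c : k) => c *: v) (fun (c : k) (w : W) => c *: w).
HB.instance Definition _ := GRing.Lmodule.copy tensor
  (btensor (fun (v : V) (c : k) => c *: v) (fun (c : k) (w : W) => c *: w)).

Definition tens (v : V) (w : W) : tensor := bt _ _ v w.

Lemma tens_bilin : bilin tens.
Proof. exact: bt_bilin. Qed.

Lemma tensE (x : tensor) : exists s : seq (V * W), x = \sum_(p <- s) tens p.1 p.2.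
Proof. by exists (repr x); apply: btE. Qed.

Section TLift.
Variable U : lmodType k.

(* The linear map on V ⊗ W induced by f, meaningful when f is bilinear. *)
Definition tlift (f : V -> W -> U) (x : tensor) : U := bt_lift f x.

Lemma bilin_balanced (f : V -> W -> U) : bilin f ->
  balanced (fun (v : V) (c : k) => c *: v) (fun (c : k) (w : W) => c *: w) f.
Proof.
case=> fl fr v c w.
have f0l : f 0 w = 0 by have := fl w (-1) 0 0; rewrite scaler0 addr0 scaleN1r addNr.
have f0r : f v 0 = 0 by have := fr v (-1) 0 0; rewrite scaler0 addr0 scaleN1r addNr.
have := fl w c v 0; have := fr v c w 0.
by rewrite /= f0l f0r !addr0 => -> ->.
Qed.

Lemma tliftE f v w : bilin f -> tlift f (tens v w) = f v w.
Proof. by move=> fb; apply: bt_liftE fb (bilin_balanced fb) v w. Qed.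

Lemma tlift_linear f : bilin f -> linear (tlift f).
Proof. by move=> fb; apply: bt_lift_linear fb (bilin_balanced fb). Qed.

Lemma tens_ext (f g : tensor -> U) : linear f -> linear g ->
  (forall v w, f (tens v w) = g (tens v w)) -> forall x, f x = g x.
Proof. exact: bt_ext. Qed.

End TLift.

(* The next lemmas hold for every f, bilinear or not. *)
Lemma eq_tlift (U : lmodType k) (f g : V -> W -> U) :
  (forall v w, f v w = g v w) -> tlift f =1 tlift g.
Proof. by move=> fg x; apply: eq_bigr => p _; apply: fg. Qed.

Lemma tliftP (U : lmodType k) (c : k) (f g : V -> W -> U) x :
  tlift (fun v w => c *: f v w + g v w) x = c *: tlift f x + tlift g x.
Proof. by rewrite /tlift /bt_lift big_split /= scaler_sumr. Qed.

Lemma tlift_comp (U U' : lmodType k) (g : U -> U') (f : V -> W -> U) x :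
  linear g -> g (tlift f x) = tlift (fun v w => g (f v w)) x.
Proof.
move=> gl; rewrite /tlift /bt_lift.
have g0 : g 0 = 0 by have := gl (-1) 0 0; rewrite scaler0 addr0 scaleN1r addNr.
elim: (repr x) => [|p s IHs]; first by rewrite !big_nil.
rewrite !big_cons -IHs.
by have := gl 1 (f p.1 p.2) (\sum_(j <- s) f j.1 j.2); rewrite !scale1r.
Qed.

End Tensor.

Arguments tens {k V W}.

Lemma tlift_exchange (k : fieldType) (V W V' W' U : lmodType k)
    (f : V -> W -> V' -> W' -> U) (x : tensor V W) (y : tensor V' W') :
  tlift (fun v w => tlift (f v w) y) x =
  tlift (fun v' w' => tlift (fun v w => f v w v' w') x) y.
Proof. by rewrite /tlift /bt_lift exchange_big. Qed.

Lemma linear_comp_fun (k : fieldType) (V W U : lmodType k)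
    (g : W -> U) (f : V -> W) : linear g -> linear f -> linear (fun v => g (f v)).
Proof. by move=> gl fl c x y; rewrite fl gl. Qed.

HB.mixin Record Lmodule_isNUAlgebra (k : fieldType) A of GRing.Lmodule k A := {
  numul : A -> A -> A;
  numulA : associative numul;
  numul_bilin : bilin numul
}.

(* Associative, not necessarily unital, k-algebras. *)
#[short(type="nuAlgType")]
HB.structure Definition NUAlgebra (k : fieldType) :=
  {A of GRing.Lmodule k A & Lmodule_isNUAlgebra k A}.

Declare Scope nualg_scope.
Delimit Scope nualg_scope with A.
Local Open Scope nualg_scope.
Notation "a ** b" := (numul a b) (at level 40, left associativity) : nualg_scope.

Section NUAlgebraTheory.
Variables (k : fieldType) (A B : nuAlgType k).

Lemma numul_linearl (b : A) : linear (fun a : A => a ** b).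
Proof. exact: (numul_bilin).1. Qed.
Lemma numul_linearr (a : A) : linear (fun b : A => a ** b).
Proof. exact: (numul_bilin).2. Qed.

Definition mulset (X Y : set A) : set A :=
  lspan [set z | exists x y, [/\ X x, Y y & z = x ** y]].

Definition idempotent_alg : Prop := mulset [set: A] [set: A] = [set: A].

Record nualg_hom := NUAlgHom {
  nualg_map :> {linear A -> B};
  nualg_mapM : forall x y : A, nualg_map (x ** y) = nualg_map x ** nualg_map y
}.

Record subalgebra := Subalgebra {
  subalg_set : set A;
  subalg0 : subalg_set 0;
  subalg_lin : forall (c : k) x y,
    subalg_set x -> subalg_set y -> subalg_set (c *: x + y);
  subalgM : forall x y, subalg_set x -> subalg_set y -> subalg_set (x ** y)
}.

End NUAlgebraTheory.

Section SubalgebraType.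
Variables (k : fieldType) (A : nuAlgType k) (X : subalgebra A).

Definition subalg_pred : {pred A} := fun x => `[< subalg_set X x >].

Record subalg_type := SubAlg {
  subalg_val :> A;
  subalg_valP : subalg_val \in subalg_pred
}.

HB.instance Definition _ := [isSub for subalg_val].
HB.instance Definition _ := [Choice of subalg_type by <:].

Lemma subalg_pred_closed : subsemimod_closed subalg_pred.
Proof.
have cl c x y : x \in subalg_pred -> y \in subalg_pred -> c *: x + y \in subalg_pred.
  by move=> /asboolP Xx /asboolP Xy; apply/asboolP; apply: subalg_lin.
have X0 : 0 \in subalg_pred by apply/asboolP; apply: subalg0.
split; first split=> //.
- by move=> x y Xx Xy; have := cl 1 x y Xx Xy; rewrite scale1r.
- by move=> c x Xx; have := cl c x 0 Xx X0; rewrite addr0.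
Qed.

HB.instance Definition _ := GRing.SubChoice_isSubLmodule.Build k A subalg_pred
  subalg_type subalg_pred_closed.

Lemma subalg_mulP (x y : subalg_type) : subalg_val x ** subalg_val y \in subalg_pred.
Proof.
case: x y => [x /asboolP Xx] [y /asboolP Xy] /=.
by apply/asboolP; apply: subalgM.
Qed.

Definition subalg_mul (x y : subalg_type) : subalg_type := SubAlg (subalg_mulP x y).

Lemma subalg_mulA : associative subalg_mul.
Proof. by move=> x y z; apply: val_inj; rewrite /= numulA. Qed.

Lemma subalg_mul_bilin : bilin subalg_mul.
Proof.
split=> [y|x] c u v; apply: val_inj => /=.
- exact: numul_linearl.
- exact: numul_linearr.
Qed.

HB.instance Definition _ :=
  Lmodule_isNUAlgebra.Build k subalg_type subalg_mulA subalg_mul_bilin.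

End SubalgebraType.

Section ImageSubalgebra.
Variables (k : fieldType) (A B : nuAlgType k) (theta : nualg_hom A B).

Lemma image0 : range theta 0.
Proof. by exists 0; rewrite ?linear0. Qed.

Lemma image_lin (c : k) x y :
  range theta x -> range theta y -> range theta (c *: x + y).
Proof.
by move=> [a _ <-] [b _ <-]; exists (c *: a + b); rewrite ?linearP.
Qed.

Lemma imageM x y : range theta x -> range theta y -> range theta (x ** y).
Proof. by move=> [a _ <-] [b _ <-]; exists (a ** b); rewrite ?nualg_mapM. Qed.

Definition image_subalg : subalgebra B := Subalgebra image0 image_lin imageM.

Lemma to_imageP (a : A) : theta a \in subalg_pred image_subalg.
Proof. by apply/asboolP; exists a. Qed.

Definition to_image (a : A) : subalg_type image_subalg := SubAlg (to_imageP a).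

End ImageSubalgebra.

(* Coassociativity is read in H ⊗ (H ⊗ H). That an algType is a nontrivial ring
   is no restriction here, by counit1. *)
HB.mixin Record Algebra_isHopf (k : fieldType) H of GRing.Algebra k H := {
  comul : {linear H -> tensor H H};
  counit : {linear H -> k^o};
  antipode : {linear H -> H};
  comulA : forall h,
    tlift (fun x y => tlift (fun x1 x2 => tens x1 (tens x2 y)) (comul x)) (comul h)
    = tlift (fun x y => tens x (comul y)) (comul h);
  counitl : forall h, tlift (fun x y => (counit x : k) *: y) (comul h) = h;
  counitr : forall h, tlift (fun x y => (counit y : k) *: x) (comul h) = h;
  comul1 : comul 1 = tens 1 1;
  comulM : forall g h, comul (g * h) =
    tlift (fun g1 g2 => tlift (fun h1 h2 => tens (g1 * h1) (g2 * h2)) (comul h))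
      (comul g);
  counit1 : counit 1 = 1 :> k;
  counitM : forall g h, counit (g * h) = (counit g : k) * (counit h : k);
  antipodel : forall h, tlift (fun x y => antipode x * y) (comul h) = (counit h : k)%:A;
  antipoder : forall h, tlift (fun x y => x * antipode y) (comul h) = (counit h : k)%:A
}.

#[short(type="hopfAlgType")]
HB.structure Definition HopfAlgebra (k : fieldType) :=
  {H of GRing.Algebra k H & Algebra_isHopf k H}.

Notation "\Delta_ ( x , y <- h ) e" := (tlift (fun x y => e) (comul h))
  (at level 36, x name, y name, h at level 200, e at level 41,
   format "\Delta_ ( x ,  y  <-  h )  e") : nualg_scope.

Section Actions.
Variables (k : fieldType) (H : hopfAlgType k).

Record partial_action (A : nuAlgType k) := PartialAction {
  pact_map : {linear tensor H A -> A};
  pact1 : forall a, pact_map (tens 1 a) = a;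
  pactM : forall h l a b,
    pact_map (tens h (a ** pact_map (tens l b))) =
    \Delta_(h1, h2 <- h) (pact_map (tens h1 a) ** pact_map (tens (h2 * l) b))
}.

Definition pact (A : nuAlgType k) (pa : partial_action A) (h : H) (a : A) : A :=
  pact_map pa (tens h a).
Coercion pact : partial_action >-> Funclass.

Definition symmetrical (A : nuAlgType k) (pa : partial_action A) : Prop :=
  forall h l a b,
    pa h (pa l b ** a) = \Delta_(h1, h2 <- h) (pa (h1 * l) b ** pa h2 a).

Record module_algebra (B : nuAlgType k) := ModuleAlgebra {
  mact_map : {linear tensor H B -> B};
  mact1 : forall b, mact_map (tens 1 b) = b;
  mactA : forall h l b, mact_map (tens (h * l) b) = mact_map (tens h (mact_map (tens l b)));
  mactM : forall h b c, mact_map (tens h (b ** c)) =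
    \Delta_(h1, h2 <- h) (mact_map (tens h1 b) ** mact_map (tens h2 c))
}.

Lemma mact_partial (B : nuAlgType k) (ma : module_algebra B) h l a b :
  mact_map ma (tens h (a ** mact_map ma (tens l b))) =
  \Delta_(h1, h2 <- h) (mact_map ma (tens h1 a) ** mact_map ma (tens (h2 * l) b)).
Proof. by rewrite mactM; apply: eq_tlift => h1 h2; rewrite mactA. Qed.

Definition partial_of_module (B : nuAlgType k) (ma : module_algebra B) :
  partial_action B := PartialAction (mact1 ma) (mact_partial ma).
Coercion partial_of_module : module_algebra >-> partial_action.

Lemma pact_bilin (A : nuAlgType k) (pa : partial_action A) : bilin pa.
Proof.
split=> [a|h] c x y; rewrite /pact.
- by rewrite (tens_bilin _ _).1 linearP.
- by rewrite (tens_bilin _ _).2 linearP.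
Qed.

End Actions.

Lemma tlift_linearP (k : fieldType) (X V W U : lmodType k) (f : X -> V -> W -> U)
    (t : tensor V W) :
  (forall v w, linear (fun x => f x v w)) -> linear (fun x => tlift (f x) t).
Proof.
move=> fl c x y /=; rewrite -tliftP; apply: eq_tlift => v w; exact: fl.
Qed.

Lemma tlift_linearT (k : fieldType) (X V W U : lmodType k) (f : V -> W -> U)
    (g : X -> tensor V W) : bilin f -> linear g -> linear (fun x => tlift f (g x)).
Proof. by move=> fb gl; apply: linear_comp_fun gl; apply: tlift_linear. Qed.

Lemma tens_linearl (k : fieldType) (X V W : lmodType k) (g : X -> V) (w : W) :
  linear g -> linear (fun x => tens (g x) w).
Proof. exact: (linear_comp_fun ((tens_bilin V W).1 w)). Qed.

Lemma tens_linearr (k : fieldType) (X V W : lmodType k) (g : X -> W) (v : V) :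
  linear g -> linear (fun x => tens v (g x)).
Proof. exact: (linear_comp_fun ((tens_bilin V W).2 v)). Qed.

Lemma mulr_linearl (k : fieldType) (A : algType k) (b : A) : linear (fun a => a * b).
Proof. by move=> c x y; rewrite mulrDl scalerAl. Qed.

Lemma mulr_linearr (k : fieldType) (A : algType k) (a : A) : linear (fun b => a * b).
Proof. by move=> c x y; rewrite mulrDr scalerAr. Qed.

Section Sweedler.
Variables (k : fieldType) (H : hopfAlgType k) (U : lmodType k).

Lemma comulM_tlift (F : H -> H -> U) (g h : H) : bilin F ->
  \Delta_(u1, u2 <- g * h) F u1 u2 =
  \Delta_(g1, g2 <- g) \Delta_(h1, h2 <- h) F (g1 * h1) (g2 * h2).
Proof.
move=> Fb; rewrite comulM (tlift_comp _ _ (tlift_linear Fb)).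
apply: eq_tlift => g1 g2; rewrite (tlift_comp _ _ (tlift_linear Fb)).
by apply: eq_tlift => h1 h2; rewrite tliftE.
Qed.

Lemma comulA_tlift (F : H -> H -> H -> U) (h : H) :
  (forall y z, linear (fun x => F x y z)) ->
  (forall x z, linear (fun y => F x y z)) ->
  (forall x y, linear (F x y)) ->
  \Delta_(x, z <- h) \Delta_(x1, x2 <- x) F x1 x2 z =
  \Delta_(x, y <- h) \Delta_(y1, y2 <- y) F x y1 y2.
Proof.
move=> F1 F2 F3.
have Gb x : bilin (F x) by split=> [z|y]; [apply: F2 | apply: F3].
have Fb : bilin (fun x t => tlift (F x) t).
  split=> [t|x]; first by apply: tlift_linearP => y z; apply: F1.
  exact: tlift_linear.
have := congr1 (tlift (fun x t => tlift (F x) t)) (comulA h).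
rewrite !(tlift_comp _ _ (tlift_linear Fb)) => e.
transitivity (\Delta_(x, y <- h) tlift (fun x' t => tlift (F x') t)
    (\Delta_(x1, x2 <- x) tens x1 (tens x2 y))).
  apply: eq_tlift => x z; rewrite (tlift_comp _ _ (tlift_linear Fb)).
  by apply: eq_tlift => x1 x2; rewrite !tliftE.
by rewrite e; apply: eq_tlift => x y; rewrite tliftE.
Qed.

End Sweedler.

(* The argument pa only serves to key the algebra structure below. An element
   a#h is tens a h. *)
Definition smash (k : fieldType) (H : hopfAlgType k) (A : nuAlgType k)
  (pa : partial_action H A) : Type := tensor A H.
HB.instance Definition _ (k : fieldType) (H : hopfAlgType k) (A : nuAlgType k)
    (pa : partial_action H A) :=
  GRing.Lmodule.copy (smash pa) (tensor A H).

Section Smash.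
Variables (k : fieldType) (H : hopfAlgType k) (A : nuAlgType k).
Variable pa : partial_action H A.

Local Notation S := (smash pa).

Lemma pact_linearl (a : A) : linear (fun h => pa h a).
Proof. exact: (pact_bilin pa).1. Qed.
Lemma pact_linearr (h : H) : linear (fun a => pa h a).
Proof. exact: (pact_bilin pa).2. Qed.

Definition smash_pure (a : A) (h : H) (b : A) (l : H) : S :=
  \Delta_(h1, h2 <- h) tens (a ** pa h1 b) (h2 * l).

Definition smash_mul (x y : S) : S :=
  tlift (fun a h => tlift (fun b l => smash_pure a h b l) y) x.

Lemma smash_core_bilin a b l :
  bilin (fun h1 h2 : H => tens (a ** pa h1 b) (h2 * l)).
Proof.
split=> [h2|h1].
- by apply: tens_linearl; apply: linear_comp_fun (pact_linearl b); apply: numul_linearr.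
- by apply: tens_linearr; apply: mulr_linearl.
Qed.

Lemma smash_pure1 h b l : linear (fun a => smash_pure a h b l).
Proof.
apply: tlift_linearP => h1 h2; apply: tens_linearl; exact: numul_linearl.
Qed.

Lemma smash_pure2 a b l : linear (fun h => smash_pure a h b l).
Proof. by apply: tlift_linearT; [apply: smash_core_bilin | apply: linearP]. Qed.

Lemma smash_pure3 a h l : linear (fun b => smash_pure a h b l).
Proof.
apply: tlift_linearP => h1 h2; apply: tens_linearl.
by apply: linear_comp_fun (pact_linearr h1); apply: numul_linearr.
Qed.

Lemma smash_pure4 a h b : linear (smash_pure a h b).
Proof. by apply: tlift_linearP => h1 h2; apply: tens_linearr; apply: mulr_linearr. Qed.

Lemma smash_pure_bilinr a h : bilin (smash_pure a h).
Proof. by split=> [l|b]; [apply: smash_pure3 | apply: smash_pure4]. Qed.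

Lemma smash_mul_bilinr (y : S) : bilin (fun a h => tlift (smash_pure a h) y).
Proof.
by split=> [h|a]; apply: tlift_linearP => b l; [apply: smash_pure1 | apply: smash_pure2].
Qed.

Lemma smash_mulE a h b l : smash_mul (tens a h) (tens b l) = smash_pure a h b l.
Proof.
rewrite /smash_mul (tliftE _ _ (smash_mul_bilinr _)).
exact: tliftE (smash_pure_bilinr a h).
Qed.

Lemma smash_mul_bilin : bilin smash_mul.
Proof.
split=> [y|x]; first exact: tlift_linear (smash_mul_bilinr y).
apply: tlift_linearP => a h; exact: tlift_linear (smash_pure_bilinr a h).
Qed.

Lemma smash_mulA : associative smash_mul.
Proof.
have Ml y := smash_mul_bilin.1 y; have Mr x := smash_mul_bilin.2 x.
move=> x y z; move: x; apply: tens_ext.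
- exact: Ml.
- exact: linear_comp_fun (Ml z) (Ml y).
move=> a h; move: y; apply: tens_ext.
- exact: linear_comp_fun (Mr _) (Ml z).
- exact: linear_comp_fun (Ml z) (Mr _).
move=> b l; move: z; apply: tens_ext.
- exact: linear_comp_fun (Mr _) (Mr _).
- exact: Mr.
move=> c m; rewrite !smash_mulE.
rewrite {1}/smash_pure (tlift_comp _ _ (Mr (tens a h))).
rewrite {1}/smash_pure (tlift_comp _ _ (Ml (tens c m))).
transitivity (\Delta_(l1, l2 <- l) \Delta_(h1, h2 <- h) \Delta_(u1, u2 <- h1)
    tens (a ** (pa u1 b ** pa (u2 * l1) c)) (h2 * (l2 * m))).
  apply: eq_tlift => l1 l2; rewrite smash_mulE; apply: eq_tlift => h1 h2.
  rewrite /pact pactM.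
  rewrite (tlift_comp _ _ (numul_linearr a)).
  exact: (tlift_comp _ _ ((tens_bilin A H).1 (h2 * (l2 * m)))).
rewrite tlift_exchange.
transitivity (\Delta_(h1, h2 <- h) \Delta_(u1, u2 <- h1) \Delta_(l1, l2 <- l)
    tens (a ** (pa u1 b ** pa (u2 * l1) c)) (h2 * (l2 * m))).
  by apply: eq_tlift => h1 h2; rewrite tlift_exchange.
rewrite (comulA_tlift (F := fun x y z => \Delta_(l1, l2 <- l)
    tens (a ** (pa x b ** pa (y * l1) c)) (z * (l2 * m)))); first last.
- move=> x y; apply: tlift_linearP => l1 l2; apply: tens_linearr.
  exact: mulr_linearl.
- move=> x z; apply: tlift_linearP => l1 l2; apply: tens_linearl.
  apply: linear_comp_fun (numul_linearr a) _.
  apply: linear_comp_fun (numul_linearr _) _.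
  exact: linear_comp_fun (pact_linearl c) (mulr_linearl l1).
- move=> y z; apply: tlift_linearP => l1 l2; apply: tens_linearl.
  apply: linear_comp_fun (numul_linearr a) _.
  exact: linear_comp_fun (numul_linearl _) (pact_linearl b).
apply: eq_tlift => h1 h2; rewrite smash_mulE.
rewrite /smash_pure (comulM_tlift _ _ (smash_core_bilin _ _ _)).
apply: eq_tlift => u1 u2; apply: eq_tlift => l1 l2.
by rewrite !numulA !mulrA.
Qed.

HB.instance Definition _ :=
  Lmodule_isNUAlgebra.Build k S smash_mulA smash_mul_bilin.

Definition psmash_set : set S :=
  mulset [set: S] (range (fun a : A => tens a 1 : S)).

Lemma psmash0 : psmash_set 0.
Proof. by exists [::]; rewrite ?big_nil. Qed.

Lemma psmash_lin (c : k) x y :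
  psmash_set x -> psmash_set y -> psmash_set (c *: x + y).
Proof.
move=> [s Xs ->] [t Xt ->].
exists ([seq (c * p.1, p.2) | p <- s] ++ t).
  move=> p; rewrite mem_cat => /orP[/mapP[q qs ->]|]; [exact: (Xs q qs) | exact: (Xt p)].
rewrite big_cat big_map scaler_sumr; congr (_ + _).
by apply: eq_bigr => p _; rewrite scalerA.
Qed.

Lemma psmashM x y : psmash_set x -> psmash_set y -> psmash_set (x ** y).
Proof.
move=> _ [s Xs ->].
elim: s Xs => [|p s IHs] Xs.
  rewrite big_nil; have := numul_linearr x (-1) 0 0.
  by rewrite scaler0 addr0 scaleN1r addNr => ->; exact: psmash0.
rewrite big_cons numul_linearr; apply: psmash_lin.
- have [u [v [_ v1 ->]]] := Xs p (mem_head _ _).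
  exists [:: (1, x ** (u ** v))]; last by rewrite big_seq1 scale1r.
  move=> q /[!inE] /eqP -> /=; exists (x ** u), v; split => //; apply: numulA.
- by apply: IHs => q qs; apply: Xs; rewrite inE qs orbT.
Qed.

Definition psmash_subalg : subalgebra S := Subalgebra psmash0 psmash_lin psmashM.

Definition psmash : Type := subalg_type psmash_subalg.
HB.instance Definition _ := NUAlgebra.copy psmash (subalg_type psmash_subalg).

End Smash.

Section Globalization.
Variables (k : fieldType) (H : hopfAlgType k) (A : nuAlgType k).
Variable pa : partial_action H A.

Record is_globalization (B : nuAlgType k) (ma : module_algebra H B)
    (theta : nualg_hom A B) : Prop := IsGlobalization {
  glob_inj : injective theta;
  glob_l : forall h a b, theta (pa h a ** b) = ma h (theta a) ** theta b;
  glob_r : forall h a b, theta (b ** pa h a) = theta b ** ma h (theta a);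
  glob_span : lspan [set b | exists h a, b = ma h (theta a)] = [set: B];
  glob_image : exists pi : partial_action H (subalg_type (image_subalg theta)),
    forall h a, pi h (to_image theta a) = to_image theta (pa h a)
}.

End Globalization.

Section Bimodules.
Variable k : fieldType.

(* No unitality is imposed, the algebras being possibly nonunital. *)
Record bimodule (R S : nuAlgType k) := Bimodule {
  bimod_sort :> lmodType k;
  lact : R -> bimod_sort -> bimod_sort;
  ract : bimod_sort -> S -> bimod_sort;
  lact_bilin : bilin lact;
  ract_bilin : bilin ract;
  lactA : forall r r' m, lact (r ** r') m = lact r (lact r' m);
  ractA : forall m s s', ract m (s ** s') = ract (ract m s) s';
  lractA : forall r m s, ract (lact r m) s = lact r (ract m s)
}.

Definition bimod_reg (R : nuAlgType k) : bimodule R R :=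
  @Bimodule R R R (@numul k R) (@numul k R) (@numul_bilin k R) (@numul_bilin k R)
    (fun r r' m => esym (numulA r r' m)) (fun m s s' => numulA m s s')
    (fun r m s => esym (numulA r m s)).

Section TensorBimodule.
Variables (R S T : nuAlgType k) (M : bimodule R S) (N : bimodule S T).

Notation MN := (btensor (@ract R S M) (@lact S T N)).
Local Notation "m *t n" := (bt (@ract R S M) (@lact S T N) m n) (at level 40).

Definition tens_lact (r : R) (t : MN) : MN := bt_lift (fun m n => lact r m *t n) t.
Definition tens_ract (t : MN) (u : T) : MN := bt_lift (fun m n => m *t ract n u) t.

Lemma tens_lact_bilin0 r : bilin (fun m n => lact r m *t n).
Proof.
split=> [n|m].
- exact: linear_comp_fun ((bt_bilin _ _).1 n) ((lact_bilin M).2 r).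
- exact: (bt_bilin _ _).2.
Qed.

Lemma tens_ract_bilin0 u : bilin (fun m n => m *t ract n u).
Proof.
split=> [n|m]; first exact: (bt_bilin _ _).1.
exact: linear_comp_fun ((bt_bilin _ _).2 m) ((ract_bilin N).1 u).
Qed.

Lemma tens_lact_bal r :
  balanced (@ract R S M) (@lact S T N) (fun m n => lact r m *t n).
Proof. by move=> m s n; rewrite -lractA bt_bal. Qed.

Lemma tens_ract_bal u :
  balanced (@ract R S M) (@lact S T N) (fun m n => m *t ract n u).
Proof. by move=> m s n; rewrite bt_bal lractA. Qed.

Lemma tens_lactE r m n : tens_lact r (m *t n) = lact r m *t n.
Proof. exact: bt_liftE (tens_lact_bilin0 r) (@tens_lact_bal r) m n. Qed.

Lemma tens_ractE m n u : tens_ract (m *t n) u = m *t ract n u.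
Proof. exact: bt_liftE (tens_ract_bilin0 u) (@tens_ract_bal u) m n. Qed.

Lemma tens_lact_linear r : linear (tens_lact r).
Proof. exact: bt_lift_linear (tens_lact_bilin0 r) (@tens_lact_bal r). Qed.

Lemma tens_ract_linear u : linear (tens_ract^~ u).
Proof. exact: bt_lift_linear (tens_ract_bilin0 u) (@tens_ract_bal u). Qed.

Lemma tens_lact_bilin : bilin tens_lact.
Proof.
split=> [t|r]; last exact: tens_lact_linear.
move=> c r r'; rewrite /tens_lact /bt_lift scaler_sumr -big_split /=.
by apply: eq_bigr => p _; rewrite (lact_bilin M).1 (bt_bilin _ _).1.
Qed.

Lemma tens_ract_bilin : bilin tens_ract.
Proof.
split=> [u|t]; first exact: tens_ract_linear.
move=> c u u'; rewrite /tens_ract /bt_lift scaler_sumr -big_split /=.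
by apply: eq_bigr => p _; rewrite (ract_bilin N).2 (bt_bilin _ _).2.
Qed.

Lemma tens_lactA r r' t : tens_lact (r ** r') t = tens_lact r (tens_lact r' t).
Proof.
move: t; apply: bt_ext; first exact: tens_lact_linear.
  exact: linear_comp_fun (tens_lact_linear _) (tens_lact_linear _).
by move=> m n; rewrite !tens_lactE lactA.
Qed.

Lemma tens_ractA t u u' : tens_ract t (u ** u') = tens_ract (tens_ract t u) u'.
Proof.
move: t; apply: bt_ext; first exact: tens_ract_linear.
  exact: linear_comp_fun (tens_ract_linear u') (tens_ract_linear u).
by move=> m n; rewrite !tens_ractE ractA.
Qed.

Lemma tens_lractA r t u : tens_ract (tens_lact r t) u = tens_lact r (tens_ract t u).
Proof.
move: t; apply: bt_ext.
- exact: linear_comp_fun (tens_ract_linear u) (tens_lact_linear r).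
- exact: linear_comp_fun (tens_lact_linear r) (tens_ract_linear u).
by move=> m n; rewrite tens_lactE !tens_ractE tens_lactE.
Qed.

Definition bimod_tens : bimodule R T :=
  Bimodule tens_lact_bilin tens_ract_bilin tens_lactA tens_ractA tens_lractA.

Definition mtens (m : M) (n : N) : bimod_tens := m *t n.

End TensorBimodule.

Record bimod_hom (R S : nuAlgType k) (M N : bimodule R S) := BimodHom {
  bimod_map :> {linear M -> N};
  bimod_mapl : forall r m, bimod_map (lact r m) = lact r (bimod_map m);
  bimod_mapr : forall m s, bimod_map (ract m s) = ract (bimod_map m) s
}.

Record morita_context (R S : nuAlgType k) := MoritaContext {
  morita_M : bimodule R S;
  morita_N : bimodule S R;
  tau : bimod_hom (bimod_tens morita_M morita_N) (bimod_reg R);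
  sigma : bimod_hom (bimod_tens morita_N morita_M) (bimod_reg S);
  tau_sigma : forall m n m', lact (tau (mtens m n)) m' = ract m (sigma (mtens n m'));
  sigma_tau : forall n m n', lact (sigma (mtens n m)) n' = ract n (tau (mtens m n'))
}.

Definition strict_morita (R S : nuAlgType k) (X : morita_context R S) : Prop :=
  (forall r : R, exists t, tau X t = r) /\ (forall s : S, exists t, sigma X t = s).

End Bimodules.

(* Main.v *)
(** Idea: inside S = B#H put E = θ(A)#1. The map Φ = θ⊗id embeds the partial
    smash product R multiplicatively in S with image ESE, and SES = S because,
    by the antipode axiom, (g ▷ xy)#l = Σ (g_1 ▷ x # g_2)(y # S(g_3)l).
    Since E = EE (A being idempotent), R is a full corner of S, and ES and SE
    with the multiplication of S form the strict Morita context. *)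
Require Import Defs.
From HB Require Import structures.
From mathcomp Require Import all_boot all_order all_algebra.
From mathcomp Require Import boolp classical_sets.

Set Implicit Arguments.
Unset Strict Implicit.
Unset Printing Implicit Defensive.

Import GRing.Theory.
Local Open Scope ring_scope.
Local Open Scope classical_set_scope.
Local Open Scope nualg_scope.

(** * Spans, products of subsets, and linear retractions *)

Section Span.
Variable k : fieldType.

Definition subspace (V : lmodType k) (P : set V) : Prop :=
  P 0 /\ forall (c : k) x y, P x -> P y -> P (c *: x + y).

Lemma linear_map0 (V W : lmodType k) (f : V -> W) : linear f -> f 0 = 0.
Proof. by move=> fl; have := fl (-1) 0 0; rewrite scaler0 addr0 scaleN1r addNr. Qed.

Lemma subspace_sum (V : lmodType k) (P : set V) (I : Type) (s : seq I)
    (F : I -> V) :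
  subspace P -> (forall i, P (F i)) -> P (\sum_(i <- s) F i).
Proof.
move=> [P0 PD] PF; elim: s => [|i s IHs]; first by rewrite big_nil.
by rewrite big_cons -[F i]scale1r; apply: PD.
Qed.

Lemma image_subspace (V W : lmodType k) (f : V -> W) : linear f ->
  subspace [set w | exists v, f v = w].
Proof.
move=> fl; split=> [|c _ _ [x <-] [y <-]]; first by exists 0; apply: linear_map0.
by exists (c *: x + y); apply: fl.
Qed.

Lemma lspan_subspace (V : lmodType k) (X : set V) : subspace (lspan X).
Proof.
split=> [|c x y [s Xs ->] [t Xt ->]]; first by exists [::]; rewrite ?big_nil.
exists ([seq (c * p.1, p.2) | p <- s] ++ t).
  by move=> p; rewrite mem_cat => /orP[/mapP[q qs ->]|]; [apply: (Xs q) | apply: Xt].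
rewrite big_cat big_map scaler_sumr; congr (_ + _).
by apply: eq_bigr => p _; rewrite scalerA.
Qed.

Lemma lspan_mem (V : lmodType k) (X : set V) x : X x -> lspan X x.
Proof.
move=> Xx; exists [:: (1, x)]; last by rewrite big_seq1 scale1r.
by move=> p /[!inE] /eqP ->.
Qed.

(** This serves as an induction principle for spans. The linear context [f] lets a nested product of
    spans be opened one factor at a time, the other factors being held inside [f]. *)
Lemma lspan_linear_in (V W : lmodType k) (X : set V) (P : set W) (f : V -> W) :
  linear f -> subspace P -> (forall x, X x -> P (f x)) ->
  forall v, lspan X v -> P (f v).
Proof.
move=> fl [P0 PD] fX _ [s Xs ->].
elim: s Xs => [|p s IHs] Xs; first by rewrite big_nil linear_map0.
rewrite big_cons fl; apply: PD; first exact/fX/Xs/mem_head.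
by apply: IHs => q qs; apply: Xs; rewrite inE qs orbT.
Qed.

Lemma tlift_in (V W U : lmodType k) (P : set U) (f : V -> W -> U) (t : tensor V W) :
  subspace P -> (forall v w, P (f v w)) -> P (tlift f t).
Proof. by move=> Ps Pf; apply: subspace_sum. Qed.

Lemma tens_linear_in (V W U : lmodType k) (P : set U) (f : tensor V W -> U) :
  linear f -> subspace P -> (forall v w, P (f (tens v w))) -> forall t, P (f t).
Proof.
move=> fl Ps fP t; have [s ->] := tensE t.
elim: s => [|p s IHs]; first by rewrite big_nil linear_map0 //; case: Ps.
by rewrite big_cons -[tens _ _]scale1r fl; case: Ps => _; apply.
Qed.

Section Mulset.
Variable S : nuAlgType k.
Implicit Types X Y P : set S.

Lemma mulset_subspace X Y : subspace (mulset X Y).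
Proof. exact: lspan_subspace. Qed.

Lemma mulset_mem X Y x y : X x -> Y y -> mulset X Y (x ** y).
Proof. by move=> Xx Yy; apply: lspan_mem; exists x, y. Qed.

Lemma mulset_linear_in (U : lmodType k) X Y (P : set U) (f : S -> U) :
  linear f -> subspace P -> (forall x y, X x -> Y y -> P (f (x ** y))) ->
  forall z, mulset X Y z -> P (f z).
Proof.
by move=> fl Ps fP; apply: lspan_linear_in => // _ [x [y [Xx Yy ->]]]; apply: fP.
Qed.

End Mulset.

Lemma linear_id (V : lmodType k) : linear (fun x : V => x).
Proof. by []. Qed.

(* A linear complement of the image of f, maximal by Zorn, gives the retraction. *)
Lemma linear_retraction (V W : lmodType k) (f : V -> W) :
  linear f -> injective f -> exists g : W -> V, linear g /\ cancel f g.
Proof.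
move=> fl finj.
(* [P] does not ask for 0 in C, because the empty chain in Zorn's lemma has empty union. [C0]
   adjoins 0 afterwards. *)
pose P (C : set W) := (forall c x y, C x -> C y -> C (c *: x + y)) /\
  (forall v, C (f v) -> v = 0).
have [F FP Fchain|C [[CD Cf] Cmax]] := @Zorn_bigcup W P.
  split=> [c x y [X FX Xx] [Y FY Yy]|v [X FX Xv]]; last exact: (FP _ FX).2.
  have [XY|YX] := Fchain X Y FX FY.
    by exists Y => //; apply: (FP _ FY).1 => //; apply: XY.
  by exists X => //; apply: (FP _ FX).1 => //; apply: YX.
pose C0 x := x = 0 \/ C x.
have CZ c x : C x -> C (c *: x).
  move=> Cx; suff C00 : C 0 by rewrite -[_ *: _]addr0; apply: CD.
  by have := CD (-1) x x Cx Cx; rewrite scaleN1r addNr.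
have C0D c x y : C0 x -> C0 y -> C0 (c *: x + y).
  move=> [->|Cx] [->|Cy]; rewrite ?scaler0 ?add0r ?addr0; [by left|by right| |].
    by right; apply: CZ.
  by right; apply: CD.
have C0f v : C0 (f v) -> v = 0.
  by case=> [fv0|/Cf//]; apply: finj; rewrite fv0 linear_map0.
have fN x : f (- x) = - f x.
  by rewrite -!scaleN1r -[_ *: x]addr0 fl linear_map0 // addr0.
have fZ c x : f (c *: x) = c *: f x by rewrite -[_ *: x]addr0 fl linear_map0 // addr0.
have dec w : exists v, C0 (w - f v).
  apply: contrapT => nw.
  (* If w is outside f(V) + C0, the span of C0 and w still meets f(V) only in 0, against the
     maximality of C. *)
  pose C' := [set z | exists x l, C0 x /\ z = l *: w + x].
  have C'C : C `<` C'.
    split=> [x Cx|C'C].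
      by exists x, 0; rewrite scale0r add0r; split=> //; right.
    apply: nw; exists 0; rewrite linear_map0 // subr0; right; apply: C'C.
    by exists 0, 1; rewrite scale1r addr0; split=> //; left.
  apply: (Cmax _ C'C); split=> [c _ _ [x [l [Cx ->]]] [y [m [Cy ->]]]|v].
    exists (c *: x + y), (c * l + m); split; first exact: C0D.
    by rewrite scalerDr scalerA scalerDl addrACA.
  move=> [x [l [Cx fv]]]; have [l0|l0] := eqVneq l 0.
    by apply: C0f; rewrite fv l0 scale0r add0r.
  (* From f v = l w + x with l nonzero, w - f(l^-1 v) = - l^-1 x lies in C0, which [nw] excludes. *)
  case: nw; exists (l^-1 *: v); rewrite fZ fv scalerDr scalerA mulVf // scale1r.
  rewrite opprD addrA subrr add0r -scaleNr -[_ *: _]addr0; apply: C0D => //.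
  by left.
have [g gP] := choice dec.
(* The difference of two decompositions of w lies in the intersection of f(V) and C0, which is 0.
   This uniqueness is what makes g linear and a left inverse of f. *)
have gu w v : C0 (w - f v) -> g w = v.
  move=> Cv; apply/eqP; rewrite -subr_eq0; apply/eqP/C0f.
  have -> : f (g w - v) = f (g w) - f v by rewrite -{1}[g w]scale1r fl fN scale1r.
  by have := C0D (-1) _ _ (gP w) Cv; rewrite scaleN1r opprB addrA subrK.
exists g; split=> [c x y|v]; apply: gu; last by left; rewrite subrr.
by rewrite fl opprD addrACA -scalerBr; apply: C0D.
Qed.

End Span.

(** * The Morita context of a full corner ESE of S *)

Section FullCorner.
Variables (k : fieldType) (R S : nuAlgType k) (Phi : nualg_hom R S) (E : set S).
Hypotheses (Phi_inj : injective Phi)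
  (E_idem : E `<=` mulset E E)
  (E_full : mulset (mulset setT E) setT = setT)
  (Phi_range : range Phi = mulset (mulset E setT) E).

Lemma right_ideal_mul x s : mulset E setT x -> mulset E setT (x ** s).
Proof.
apply: (mulset_linear_in (numul_linearl s)); first exact: mulset_subspace.
by move=> e t Ee _; rewrite -numulA; apply: mulset_mem.
Qed.

Lemma left_ideal_mul s x : mulset setT E x -> mulset setT E (s ** x).
Proof.
apply: (mulset_linear_in (numul_linearr s)); first exact: mulset_subspace.
by move=> t e _ Ee; rewrite numulA; apply: mulset_mem.
Qed.

(** Packaging ES, and likewise SE below, as a subalgebra lets [subalg_type] supply the vector space
    that carries the bimodule. *)
Definition right_ideal : subalgebra S :=
  Subalgebra (mulset_subspace E setT).1 (mulset_subspace E setT).2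
    (fun x y Mx _ => right_ideal_mul y Mx).

Definition left_ideal : subalgebra S :=
  Subalgebra (mulset_subspace setT E).1 (mulset_subspace setT E).2
    (fun x y _ Ny => left_ideal_mul x Ny).

Local Notation M := (subalg_type right_ideal).
Local Notation N := (subalg_type left_ideal).

Lemma M_in (m : M) : mulset E setT (m : S).
Proof. by case: m => m /= /asboolP. Qed.

Lemma N_in (n : N) : mulset setT E (n : S).
Proof. by case: n => n /= /asboolP. Qed.

Lemma corner_in_right z : mulset (mulset E setT) E z -> mulset E setT z.
Proof.
apply: (mulset_linear_in (@linear_id _ _)); first exact: mulset_subspace.
by move=> x e Mx _; apply: right_ideal_mul.
Qed.

Lemma corner_in_left z : mulset (mulset E setT) E z -> mulset setT E z.
Proof.
apply: (mulset_linear_in (@linear_id _ _)); first exact: mulset_subspace.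
by move=> x e _ Ee; apply: mulset_mem.
Qed.

Lemma Phi_corner r : mulset (mulset E setT) E (Phi r).
Proof. by rewrite -Phi_range; exists r. Qed.

Fact M_lact_in (r : R) (m : M) : Phi r ** m \in subalg_pred right_ideal.
Proof. by apply/asboolP/right_ideal_mul/corner_in_right/Phi_corner. Qed.
Fact M_ract_in (m : M) (s : S) : (m : S) ** s \in subalg_pred right_ideal.
Proof. by apply/asboolP/right_ideal_mul/M_in. Qed.
Fact N_lact_in (s : S) (n : N) : s ** n \in subalg_pred left_ideal.
Proof. by apply/asboolP/left_ideal_mul/N_in. Qed.
Fact N_ract_in (n : N) (r : R) : (n : S) ** Phi r \in subalg_pred left_ideal.
Proof. by apply/asboolP/left_ideal_mul/corner_in_left/Phi_corner. Qed.

Definition M_lact (r : R) (m : M) : M := SubAlg (M_lact_in r m).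
Definition M_ract (m : M) (s : S) : M := SubAlg (M_ract_in m s).
Definition N_lact (s : S) (n : N) : N := SubAlg (N_lact_in s n).
Definition N_ract (n : N) (r : R) : N := SubAlg (N_ract_in n r).

Lemma M_lact_bilin : bilin M_lact.
Proof.
by split=> [m|r] c x y; apply: val_inj; rewrite /= ?linearP (numul_linearl, numul_linearr).
Qed.
Lemma M_ract_bilin : bilin M_ract.
Proof.
by split=> [s|m] c x y; apply: val_inj; rewrite /= (numul_linearl, numul_linearr).
Qed.
Lemma N_lact_bilin : bilin N_lact.
Proof.
by split=> [n|s] c x y; apply: val_inj; rewrite /= (numul_linearl, numul_linearr).
Qed.
Lemma N_ract_bilin : bilin N_ract.
Proof.
by split=> [r|n] c x y; apply: val_inj; rewrite /= ?linearP (numul_linearl, numul_linearr).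
Qed.

Lemma M_lactA r r' m : M_lact (r ** r') m = M_lact r (M_lact r' m).
Proof. by apply: val_inj; rewrite /= nualg_mapM numulA. Qed.
Lemma M_ractA m s s' : M_ract m (s ** s') = M_ract (M_ract m s) s'.
Proof. by apply: val_inj; rewrite /= numulA. Qed.
Lemma M_lractA r m s : M_ract (M_lact r m) s = M_lact r (M_ract m s).
Proof. by apply: val_inj; rewrite /= numulA. Qed.
Lemma N_lactA s s' n : N_lact (s ** s') n = N_lact s (N_lact s' n).
Proof. by apply: val_inj; rewrite /= numulA. Qed.
Lemma N_ractA n r r' : N_ract n (r ** r') = N_ract (N_ract n r) r'.
Proof. by apply: val_inj; rewrite /= nualg_mapM numulA. Qed.
Lemma N_lractA s n r : N_ract (N_lact s n) r = N_lact s (N_ract n r).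
Proof. by apply: val_inj; rewrite /= numulA. Qed.

Definition corner_M : bimodule R S :=
  Bimodule M_lact_bilin M_ract_bilin M_lactA M_ractA M_lractA.
Definition corner_N : bimodule S R :=
  Bimodule N_lact_bilin N_ract_bilin N_lactA N_ractA N_lractA.

(** (ES)(SE) lies in ESE, the image of [Phi]. Hence the product of S on ES and SE can be read as a
    pairing with values in R. *)
Lemma MN_in_range (m : M) (n : N) : exists r, Phi r = (m : S) ** n.
Proof.
suff: range Phi ((m : S) ** n) by case=> r _; exists r.
rewrite Phi_range; have := N_in n.
apply: (mulset_linear_in (numul_linearr (m : S))); first exact: mulset_subspace.
move=> s e _ Ee; rewrite numulA; apply: mulset_mem => //.
exact/right_ideal_mul/M_in.
Qed.

(** The preimage is obtained by choice but is unique, [Phi] being injective. Identities for it in R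
    are therefore checked in S after applying [Phi]. *)
Definition corner_pairing (m : M) (n : N) : R := sval (cid (MN_in_range m n)).

Lemma corner_pairingE m n : Phi (corner_pairing m n) = (m : S) ** n.
Proof. exact: svalP (cid (MN_in_range m n)). Qed.

Lemma corner_pairing_bilin : bilin corner_pairing.
Proof.
split=> [n|m] c x y; apply: Phi_inj; rewrite linearP !corner_pairingE /=.
- exact: numul_linearl.
- exact: numul_linearr.
Qed.

Lemma corner_pairing_balanced : balanced M_ract N_lact corner_pairing.
Proof. by move=> m s n; apply: Phi_inj; rewrite !corner_pairingE /= numulA. Qed.

Definition corner_mul (n : N) (m : M) : S := (n : S) ** m.

Lemma corner_mul_bilin : bilin corner_mul.
Proof. by split=> [m|n] c x y; rewrite /corner_mul (numul_linearl, numul_linearr). Qed.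

Lemma corner_mul_balanced : balanced N_ract M_lact corner_mul.
Proof. by move=> n r m; rewrite /corner_mul /= numulA. Qed.

Definition corner_tau0 : bimod_tens corner_M corner_N -> R := bt_lift corner_pairing.
Definition corner_sigma0 : bimod_tens corner_N corner_M -> S := bt_lift corner_mul.

Lemma corner_tau_linear : linear corner_tau0.
Proof. exact: bt_lift_linear corner_pairing_bilin corner_pairing_balanced. Qed.
Lemma corner_sigma_linear : linear corner_sigma0.
Proof. exact: bt_lift_linear corner_mul_bilin corner_mul_balanced. Qed.

HB.instance Definition _ := GRing.isLinear.Build k _ _ _ corner_tau0 corner_tau_linear.
HB.instance Definition _ := GRing.isLinear.Build k _ _ _ corner_sigma0 corner_sigma_linear.

Lemma corner_tauE m n :
  corner_tau0 (@mtens k R S R corner_M corner_N m n) = corner_pairing m n.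
Proof. exact: bt_liftE corner_pairing_bilin corner_pairing_balanced m n. Qed.
Lemma corner_sigmaE n m :
  corner_sigma0 (@mtens k S R S corner_N corner_M n m) = corner_mul n m.
Proof. exact: bt_liftE corner_mul_bilin corner_mul_balanced n m. Qed.

Lemma corner_tau_lact r t : corner_tau0 (lact r t) = r ** corner_tau0 t.
Proof.
move: t; apply: bt_ext => [||m n].
- exact: linear_comp_fun corner_tau_linear
    (tens_lact_linear (M := corner_M) (N := corner_N) r).
- exact: linear_comp_fun (numul_linearr r) corner_tau_linear.
rewrite [lact r _](tens_lactE (M := corner_M) (N := corner_N)) !corner_tauE.
by apply: Phi_inj; rewrite nualg_mapM !corner_pairingE /= numulA.
Qed.

Lemma corner_tau_ract t r : corner_tau0 (ract t r) = corner_tau0 t ** r.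
Proof.
move: t; apply: bt_ext => [||m n].
- exact: linear_comp_fun corner_tau_linear
    (tens_ract_linear (M := corner_M) (N := corner_N) r).
- exact: linear_comp_fun (numul_linearl r) corner_tau_linear.
rewrite [ract _ r](tens_ractE (M := corner_M) (N := corner_N)) !corner_tauE.
by apply: Phi_inj; rewrite nualg_mapM !corner_pairingE /= numulA.
Qed.

Lemma corner_sigma_lact s t : corner_sigma0 (lact s t) = s ** corner_sigma0 t.
Proof.
move: t; apply: bt_ext => [||n m].
- exact: linear_comp_fun corner_sigma_linear
    (tens_lact_linear (M := corner_N) (N := corner_M) s).
- exact: linear_comp_fun (numul_linearr s) corner_sigma_linear.
rewrite [lact s _](tens_lactE (M := corner_N) (N := corner_M)) !corner_sigmaE.
by rewrite /corner_mul /= numulA.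
Qed.

Lemma corner_sigma_ract t s : corner_sigma0 (ract t s) = corner_sigma0 t ** s.
Proof.
move: t; apply: bt_ext => [||n m].
- exact: linear_comp_fun corner_sigma_linear
    (tens_ract_linear (M := corner_N) (N := corner_M) s).
- exact: linear_comp_fun (numul_linearl s) corner_sigma_linear.
rewrite [ract _ s](tens_ractE (M := corner_N) (N := corner_M)) !corner_sigmaE.
by rewrite /corner_mul /= numulA.
Qed.

Definition corner_tau : bimod_hom (bimod_tens corner_M corner_N) (bimod_reg R) :=
  @BimodHom k R R (bimod_tens corner_M corner_N) (bimod_reg R) corner_tau0
    corner_tau_lact corner_tau_ract.
Definition corner_sigma : bimod_hom (bimod_tens corner_N corner_M) (bimod_reg S) :=
  @BimodHom k S S (bimod_tens corner_N corner_M) (bimod_reg S) corner_sigma0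
    corner_sigma_lact corner_sigma_ract.

Lemma corner_tau_sigma (m : corner_M) (n : corner_N) (m' : corner_M) :
  lact (corner_tau (mtens m n) : R) m' = ract m (corner_sigma (mtens n m') : S).
Proof.
apply: val_inj; rewrite /= corner_tauE corner_sigmaE corner_pairingE.
by rewrite /corner_mul numulA.
Qed.

Lemma corner_sigma_tau (n : corner_N) (m : corner_M) (n' : corner_N) :
  lact (corner_sigma (mtens n m) : S) n' = ract n (corner_tau (mtens m n') : R).
Proof.
apply: val_inj; rewrite /= corner_tauE corner_sigmaE corner_pairingE.
by rewrite /corner_mul numulA.
Qed.

Definition corner_context : morita_context R S :=
  MoritaContext corner_tau_sigma corner_sigma_tau.

(** Both surjectivities come from splitting the middle or left factor by [E_idem]: e s f in ESE
    becomes a sum of terms (e' e'')(s f) in (ES)(SE), and x e y in SES = S becomes a sum of terms (x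
    e')(e'' y) in (SE)(ES). *)
Lemma corner_strict : strict_morita corner_context.
Proof.
have MT e s : E e -> e ** s \in subalg_pred right_ideal.
  by move=> Ee; apply/asboolP; apply: mulset_mem.
have NT e s : E e -> s ** e \in subalg_pred left_ideal.
  by move=> Ee; apply/asboolP; apply: mulset_mem.
split=> [r|s].
- have Psub := image_subspace (linear_comp_fun (linearP Phi) corner_tau_linear).
  (* Working in S rather than in R makes the generators e s f of ESE available. *)
  suff [t tr] : exists t, Phi (corner_tau0 t) = Phi r by exists t; apply: Phi_inj.
  move: (Phi r) (Phi_corner r); apply: (mulset_linear_in (@linear_id _ _) Psub).
  move=> x f Mx Ef; move: x Mx.
  apply: (mulset_linear_in (numul_linearl f) Psub) => e s Ee _.
  rewrite -numulA; have {Ee} := E_idem Ee; move: e.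
  apply: (mulset_linear_in (numul_linearl (s ** f)) Psub) => e e' Ee Ee'.
  exists (mtens (SubAlg (MT _ e' Ee) : corner_M) (SubAlg (NT _ s Ef) : corner_N)).
  by rewrite corner_tauE corner_pairingE.
- have Psub := image_subspace corner_sigma_linear.
  have : mulset (mulset setT E) setT s by rewrite E_full.
  apply: (mulset_linear_in (@linear_id _ _) Psub) => x y + _; move: x.
  apply: (mulset_linear_in (numul_linearl y) Psub) => x e _ Ee.
  have {Ee} := E_idem Ee; move: e.
  apply: (mulset_linear_in (linear_comp_fun (numul_linearl y) (numul_linearr x)) Psub).
  move=> e e' Ee Ee'.
  exists (mtens (SubAlg (NT _ x Ee) : corner_N) (SubAlg (MT _ y Ee') : corner_M)).
  by rewrite corner_sigmaE /corner_mul /= !numulA.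
Qed.

End FullCorner.

(** * The map of smash products induced by [theta], and the antipode identity *)

Section SmashEmbedding.
Variables (k : fieldType) (H : hopfAlgType k) (A B : nuAlgType k).
Variables (pa : partial_action H A) (ma : module_algebra H B).
Variable theta : nualg_hom A B.

Definition smash_map (x : smash pa) : smash ma :=
  tlift (fun a h => tens (theta a) h) x.

Lemma smash_map_bilin : bilin (fun a (h : H) => tens (theta a) h).
Proof.
split=> [h|a]; first exact: tens_linearl (linearP theta).
exact: (tens_bilin _ _).2.
Qed.

Lemma smash_map_linear : linear smash_map.
Proof. exact: tlift_linear smash_map_bilin. Qed.

Lemma smash_mapE a h : smash_map (tens a h) = tens (theta a) h.
Proof. exact: tliftE smash_map_bilin. Qed.

(** Over a field [theta] has a linear retraction g, and g tensored with the identity of H is a left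
    inverse of [smash_map]. *)
Lemma smash_map_inj : injective theta -> injective smash_map.
Proof.
move=> theta_inj; have [g [gl gK]] := linear_retraction (linearP theta) theta_inj.
have gb : bilin (fun b (h : H) => tens (g b) h).
  by split=> [h|b]; [apply: tens_linearl | apply: (tens_bilin _ _).2].
apply: (can_inj (g := tlift (fun b h => tens (g b) h))).
apply: tens_ext => [||a h]; first exact: linear_comp_fun (tlift_linear gb) smash_map_linear.
  exact: linear_id.
by rewrite smash_mapE tliftE // gK.
Qed.

Lemma smash_tensM (C : nuAlgType k) (pc : partial_action H C) a h b l :
  (tens a h : smash pc) ** tens b l = smash_pure pc a h b l.
Proof. exact: smash_mulE. Qed.

Lemma smash_tens1M (C : nuAlgType k) (pc : partial_action H C) a b l :
  (tens a 1 : smash pc) ** tens b l = tens (a ** b) l.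
Proof.
rewrite smash_tensM /smash_pure comul1 tliftE; last exact: smash_core_bilin.
by rewrite /pact pact1 mul1r.
Qed.

(** The action enters a smash product only through factors a(h_1 · b), which is exactly the shape
    that the assumed identity carries over to B. *)
Lemma smash_mapM :
  (forall h a b, theta (b ** pa h a) = theta b ** ma h (theta a)) ->
  forall x y, smash_map (x ** y) = smash_map x ** smash_map y.
Proof.
move=> theta_act x y; move: x; apply: tens_ext => [||a h].
- exact: linear_comp_fun smash_map_linear (numul_linearl y).
- exact: linear_comp_fun (numul_linearl _) smash_map_linear.
move: y; apply: tens_ext => [||b l].
- exact: linear_comp_fun smash_map_linear (numul_linearr _).
- exact: linear_comp_fun (numul_linearr _) smash_map_linear.
rewrite !smash_mapE !smash_tensM /smash_pure (tlift_comp _ _ smash_map_linear).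
by apply: eq_tlift => h1 h2; rewrite smash_mapE theta_act.
Qed.

(** The right-hand side expands to the sum of (g_1 ▷ x)(g_2 ▷ y) # g_3 S(g_4) l, and g_3 S(g_4)
    collapses to a counit. The identity trades a translate of a product for smash products whose
    right factor y # m has its B-component untouched by the action. *)
Lemma smash_act_mul (g l : H) (x y : B) :
  (tens (ma g (x ** y)) l : smash ma) =
  \Delta_(g1, g2 <- g) ((\Delta_(u1, u2 <- g1) tens (ma u1 x) u2 : smash ma) **
                        tens y (antipode g2 * l)).
Proof.
pose F (p q : H) := tens (ma p (x ** y)) q : smash ma.
have FX (f : H -> H) q : linear f -> linear (fun p => F (f p) q).
  move=> fl; apply: tens_linearl; exact: linear_comp_fun (pact_linearl ma _) fl.
have FY (f : H -> H) p : linear f -> linear (fun q => F p (f q)).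
  by move=> fl; apply: tens_linearr.
have Fb : bilin F by split=> [q|p]; [apply: FX | apply: FY].
have lin_anti (z : H) : linear (fun v : H => z * (antipode v * l)).
  apply: linear_comp_fun (mulr_linearr z) _.
  exact: linear_comp_fun (mulr_linearl l) (linearP _).
(* Both sides equal the sum of (g_1 ▷ xy) # g_2 S(g_3) l. For the left-hand side, coassociativity
   groups g_2 with S(g_3), and the antipode axiom applies. *)
transitivity (\Delta_(g1, g2 <- g) \Delta_(u1, u2 <- g1) F u1 (u2 * (antipode g2 * l))).
  rewrite (comulA_tlift (F := fun p q r => F p (q * (antipode r * l)))).
  - transitivity (\Delta_(g1, g2 <- g) F g1 ((counit g2 : k) *: l)).
      (* [counitr] read backwards writes g as the sum of ε(g_2) g_1; the scalar then crosses the
         tensor to l. *)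
      rewrite -[in LHS](counitr g) -/(F _ l) (tlift_comp _ _ (Fb.1 l)).
      apply: eq_tlift => g1 g2.
      exact: bilin_balanced Fb _ _ _.
    apply: eq_tlift => g1 g2.
    rewrite -[_ *: l]mulr_algl -antipoder.
    rewrite (tlift_comp _ _ (mulr_linearl l)) (tlift_comp _ _ (Fb.2 g1)).
    by apply: eq_tlift => v1 v2; rewrite mulrA.
  - by move=> q r; apply: FX.
  - by move=> p r; apply: FY; apply: mulr_linearl.
  - by move=> p q; apply: FY.
(* For the right-hand side, g_1 ▷ xy is distributed over x and y, and coassociativity brings the
   indices into the order of the smash product. *)
apply: eq_tlift => g1 g2; rewrite (tlift_comp _ _ (numul_linearl _)).
transitivity (\Delta_(u1, u2 <- g1) \Delta_(v1, v2 <- u1)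
   (tens (ma v1 x ** ma v2 y) (u2 * (antipode g2 * l)) : smash ma)).
  apply: eq_tlift => u1 u2; rewrite /F /pact /= mactM.
  by rewrite (tlift_comp _ _ ((tens_bilin B H).1 _)).
rewrite (comulA_tlift (F := fun p q r =>
   tens (ma p x ** ma q y) (r * (antipode g2 * l)) : smash ma)).
- by apply: eq_tlift => u1 u2; rewrite smash_tensM.
- move=> q r; apply: tens_linearl.
  exact: linear_comp_fun (numul_linearl _) (pact_linearl ma _).
- move=> p r; apply: tens_linearl.
  exact: linear_comp_fun (numul_linearr _) (pact_linearl ma _).
- by move=> p q; apply: tens_linearr; apply: mulr_linearl.
Qed.

End SmashEmbedding.

(** * The corner of B#H cut out by θ(A)#1 *)

Section Main.
Variables (k : fieldType) (H : hopfAlgType k) (A B : nuAlgType k).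
Variables (A_idem : idempotent_alg A) (pa : partial_action H A).
Variables (ma : module_algebra H B) (theta : nualg_hom A B).
Hypothesis glob : is_globalization pa ma theta.

Definition glob_corner : set (smash ma) := range (fun a => tens (theta a) 1).

Local Notation E := glob_corner.
Local Notation Phi0 := (@smash_map k H A B pa ma theta).

(** This is how A = A^2 is used throughout: an element of A in a linear position may be taken to be
    a product, which replaces inserting a unit. *)
Lemma idempotent_linear_in (U : lmodType k) (P : set U) (f : A -> U) :
  linear f -> subspace P -> (forall a b, P (f (a ** b))) -> forall a, P (f a).
Proof.
move=> fl Ps fP a; have : mulset [set: A] [set: A] a by rewrite A_idem.
by apply: (mulset_linear_in fl Ps) => x y _ _; apply: fP.
Qed.

Lemma glob_corner_mem a : E (tens (theta a) 1).
Proof. by exists a. Qed.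

Lemma tens_theta_linear (h : H) : linear (fun a => tens (theta a) h : smash ma).
Proof. exact: tens_linearl (linearP theta). Qed.

Lemma glob_corner_idem : E `<=` mulset E E.
Proof.
move=> _ [a _ <-]; move: a.
apply: (idempotent_linear_in (tens_theta_linear 1)) => [|a b]; first exact: mulset_subspace.
by rewrite nualg_mapM -smash_tens1M; apply: mulset_mem; apply: glob_corner_mem.
Qed.

(** B#H is spanned by the elements (g ▷ θ(a)) # l. Once a is a product, [smash_act_mul] writes such
    an element as a sum of terms s (θ(a') # m), and it remains to find a factor from E in the
    middle. *)
Lemma glob_corner_full : mulset (mulset setT E) setT = setT.
Proof.
pose P := mulset (mulset setT E) [set: smash ma].
have Ps : subspace P := mulset_subspace _ _.
apply/seteqP; split=> // s _; move: s.
apply: (tens_linear_in (@linear_id _ _) Ps) => b l.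
have : lspan [set b | exists h a, b = ma h (theta a)] b by rewrite (glob_span glob).
apply: (lspan_linear_in ((tens_bilin B H).1 l) Ps) => _ [g [a ->]]; move: a.
have tl : linear (fun a => tens (ma g (theta a)) l : smash ma).
  apply: tens_linearl; exact: linear_comp_fun (pact_linearr ma g) (linearP theta).
apply: (idempotent_linear_in tl Ps) => a a'.
rewrite nualg_mapM smash_act_mul; apply: tlift_in => // g1 g2.
(* Idempotence is used a second time: θ(b1 b2) # m = (θ(b1) # 1)(θ(b2) # m) exposes the factor from
   E. *)
move: a'; apply: (idempotent_linear_in (linear_comp_fun (numul_linearr _)
  (tens_theta_linear _)) Ps) => b1 b2.
rewrite nualg_mapM -smash_tens1M numulA.
by apply: mulset_mem => //; apply: mulset_mem => //; apply: glob_corner_mem.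
Qed.

Definition psmash_embed0 (x : psmash pa) : smash ma := Phi0 (subalg_val x).

Lemma psmash_embed_linear : linear psmash_embed0.
Proof. by move=> c x y; apply: smash_map_linear. Qed.

HB.instance Definition _ :=
  GRing.isLinear.Build k _ _ _ psmash_embed0 psmash_embed_linear.

Lemma psmash_embedM x y : psmash_embed0 (x ** y) = psmash_embed0 x ** psmash_embed0 y.
Proof. exact: smash_mapM (glob_r glob) _ _. Qed.

Definition psmash_embed : nualg_hom (psmash pa) (smash ma) := NUAlgHom psmash_embedM.

Lemma psmash_embed_inj : injective psmash_embed.
Proof. by move=> x y /(smash_map_inj (glob_inj glob)) xy; apply: val_inj. Qed.

(** One inclusion rests on A = A^2, which turns θ(a)#h into a sum of elements of ES. The other rests
    on θ(a)(g ▷ θ(a')) = θ(a(g · a')): left multiplication by θ(a) brings B = H ▷ θ(A) back into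
    θ(A). *)
Lemma psmash_embed_range : range psmash_embed = mulset (mulset E setT) E.
Proof.
have Phil := @smash_map_linear k H A B pa ma theta.
apply/seteqP; split.
  move=> _ [[x xP] _ <-]; rewrite /= /psmash_embed0 /=.
  move/asboolP: {xP} (xP); move: x.
  apply: (mulset_linear_in Phil); first exact: mulset_subspace.
  move=> z _ _ [b _ <-]; rewrite (smash_mapM (glob_r glob)) smash_mapE.
  apply: mulset_mem; last exact: glob_corner_mem.
  move: z; apply: (tens_linear_in Phil); first exact: mulset_subspace.
  move=> a h; rewrite smash_mapE; move: a.
  apply: (idempotent_linear_in (tens_theta_linear h)); first exact: mulset_subspace.
  move=> a a'; rewrite nualg_mapM -smash_tens1M.
  by apply: mulset_mem => //; apply: glob_corner_mem.
have Ps := image_subspace (linearP psmash_embed).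
have sub z : mulset (mulset E setT) E z -> exists x, psmash_embed x = z.
  apply: (mulset_linear_in (@linear_id _ _) Ps) => y _ + [c _ <-]; move: y.
  apply: (mulset_linear_in (numul_linearl _) Ps) => _ s [a _ <-] _; move: s.
  have ac_lin : linear (fun s : smash ma =>
      (tens (theta a) 1 : smash ma) ** s ** (tens (theta c) 1 : smash ma)).
    exact: linear_comp_fun (numul_linearl _) (numul_linearr _).
  apply: (tens_linear_in ac_lin Ps) => b h.
  have : lspan [set b | exists h a, b = ma h (theta a)] b by rewrite (glob_span glob).
  apply: (lspan_linear_in (linear_comp_fun ac_lin ((tens_bilin B H).1 h)) Ps).
  move=> _ [g [a' ->]].
  (* The preimage of (θ(a)#1)((g ▷ θ(a'))#h)(θ(c)#1) is (a(g · a')#h)(c#1), which has the form of a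
     generator of the partial smash product. *)
  have mP : (tens (a ** pa g a') h : smash pa) ** tens c 1 \in
      subalg_pred (psmash_subalg pa).
    by apply/asboolP; apply: mulset_mem => //; exists c.
  exists (SubAlg mP); rewrite /= /psmash_embed0 /= (smash_mapM (glob_r glob)).
  by rewrite !smash_mapE smash_tens1M (glob_r glob).
by move=> z /sub[x <-]; exists x.
Qed.

End Main.

Theorem theorem67 (k : fieldType) (H : hopfAlgType k)
    (antipode_bij : bijective (@antipode k H))
    (A : nuAlgType k) (A_idem : idempotent_alg A)
    (pa : partial_action H A) (pa_sym : symmetrical pa)
    (B : nuAlgType k) (ma : module_algebra H B) (theta : nualg_hom A B)
    (glob : is_globalization pa ma theta) :
  exists X : morita_context (psmash pa) (smash ma), strict_morita X.
Proof.
have inj : injective (psmash_embed glob) by move=> x y; apply: psmash_embed_inj.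
exists (corner_context inj (psmash_embed_range A_idem glob)); apply: corner_strict.
- by move=> e; apply: glob_corner_idem.
- exact (glob_corner_full A_idem glob).
Qed.
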